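(* Let $(X,\lambda)$ be a convergence approach space and let $(X,\mathrm T\lambda)$ be its approach reflection. Then the map $\mathscr{C}:V^X\to\mathscr{C}(X,V)\subset V^X$ given by $$\mathscr{C}(f)=\bigwedge\{g\in\mathscr{C}(X,V): f\le g\}$$ is the lower-hull operator for $(X,\mathrm T\lambda)$, and the corresponding lower regular function frame is $\mathscr{C}(X,V)$.
   Context: Throughout, $V=[0,1]$ with its usual order and $\otimes$ is multiplication (equivalently, via $-\ln$, $V=[0,\infty]^{op}$ with $\otimes=+$). Division is $t\oslash x=\min(t/x,1)$ if $x\neq 0$ and $t\oslash 0=1$. Filters are proper; $\mathbb{F}X$ (resp. $\mathbb{U}X$) is the set of filters (resp. ultrafilters) on $X$, and $\{x\}^{\uparrow}$ is the principal ultrafilter of $x$. $V^X$ carries the pointwise order. A convergence approach space $(X,\lambda)$ is a set $X$ with a map $\lambda:\mathbb{F}X\to V^X$ such that $\mathcal F\subset\mathcal G$ implies $\lambda(\mathcal F)\le\lambda(\mathcal G)$, and $\lambda(\{x\}^{\uparrow})(x)=1$ for all $x$. A morphism $f:(X,\lambda_X)\to(Y,\lambda_Y)$ is a map with $\lambda_X(\mathcal F)(x)\le\lambda_Y(f[\mathcal F])(f(x))$ for all $\mathcal F\in\mathbb{F}X$, $x\in X$, where $f[\mathcal F]$ is the image filter. $V$ carries the structure $\lambda_V(\mathcal F)(v)=v\oslash\bigwedge_{F\in\mathcal F}\bigvee F$, and $\mathscr{C}(X,V)$ is the set of morphisms $(X,\lambda)\to(V,\lambda_V)$, which is closed under arbitrary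 pointwise infima. For $A\subset X$, $\operatorname{adh}_\lambda A(x)=\bigvee\{\lambda(\mathcal U)(x):\mathcal U\in\mathbb{U}X,\ A\in\mathcal U\}$ (with $\bigvee\emptyset=0$), and $A^{(\epsilon)}=\{x\in X:\operatorname{adh}_\lambda A(x)\ge\epsilon\}$. $(X,\lambda)$ is a pre-approach space if $\lambda(\bigcap_{\mathcal D\in\mathbb D}\mathcal D)=\bigwedge_{\mathcal D\in\mathbb D}\lambda(\mathcal D)$ for every family $\mathbb D\subset\mathbb{F}X$ (the empty family being excluded, as its intersection is not a proper filter); it is an approach space if moreover $\operatorname{adh}_\lambda A(x)\ge\operatorname{adh}_\lambda A^{(\epsilon)}(x)\otimes\epsilon$ for all $A\subset X$, $x\in X$, $\epsilon\in V$. The approach reflection of $(X,\lambda)$ is the approach space $(X,\mathrm T\lambda)$ such that $\mathrm{id}_X:(X,\lambda)\to(X,\mathrm T\lambda)$ is a morphism and every morphism from $(X,\lambda)$ to an approach space is a morphism from $(X,\mathrm T\lambda)$. A lower-hull operator on $X$ is a map $\mathfrak l:V^X\to V^X$ such that for all $f,g\in V^X$, $v\in V$: (1) $f\le\mathfrak l(f)$; (2) $\mathfrak l(f\vee g)=\mathfrak l(f)\vee\mathfrak l(g)$; (3) $\mathfrak l(\mathfrak l(f))=\mathfrak l(f)$; (4) $\mathfrak l(f\otimes v)=\mathfrak l(f)\otimes v$. The lower-hull operator for an approach space $(X,\mu)$ is the (unique) lower-hull operator $\mathfrak l$ with $\mathfrak l(\theta_A)=\operatorname{adh}_\mu A$ for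 every $A\subset X$, where $\theta_A$ is the indicator function of $A$; the corresponding lower regular function frame is the set of fixed points of $\mathfrak l$. *)

(* Defs.v *)
From mathcomp Require Import all_boot all_order all_algebra.
From mathcomp Require Import interval_inference.
From mathcomp Require Import mathcomp_extra boolp classical_sets functions.
From mathcomp Require Import filter reals.

Set Implicit Arguments.
Unset Strict Implicit.
Unset Printing Implicit Defensive.
Import Order.TTheory GRing.Theory Num.Theory.
Local Open Scope classical_set_scope.
Local Open Scope ring_scope.

Section Quantale.
Variable R : realType.

(* V = [0,1] with its usual order; [V^X] is [X -> {i01 R}], on which the
   library's order and join are the pointwise ones. *)
Definition tensor (s t : {i01 R}) : {i01 R} := (s%:num * t%:num)%:i01.

(* The test is needed: the library's convention is [t / 0 = 0]. *)
Definition vdiv (t x : {i01 R}) : {i01 R} :=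
  if x == 0%:i01 then 1%:i01 else (Num.min (t%:num / x%:num) 1)%:i01.

(* Suprema and infima in V; the first argument is the value on the empty set.
   It is also the library's default value when no supremum exists, but that
   never happens in V (see [vsupP] and [vinfP]). *)
Definition vsup (A : set {i01 R}) : {i01 R} := supremum 0%:i01 A.
Definition vinf (A : set {i01 R}) : {i01 R} := infimum 1%:i01 A.

Lemma supremums_neq0 (A : set {i01 R}) : supremums A !=set0.
Proof.
have [->|A0] := eqVneq A set0.
  by exists 0%:i01; split => // x _; rewrite -num_le/=.
have /set0P[a Aa] := A0.
pose B := [set x%:num | x in A].
have B1 : ubound B 1 by move=> _ [x _ <-].
have hB : has_sup B by split; [exists a%:num, a | exists 1].
have s0 : 0 <= sup B.
  by apply: (@le_trans _ _ a%:num) => //; apply: ub_le_sup; [exists 1|exists a].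
have s1 : sup B <= 1 by apply: ge_sup => //; exists a%:num, a.
exists (Itv01 s0 s1); split=> [x Ax|b bA].
  by rewrite -num_le/=; apply: ub_le_sup; [exists 1|exists x].
rewrite -num_le/=; apply: ge_sup; first by exists a%:num, a.
by move=> _ [x Ax <-]; rewrite num_le; exact: bA.
Qed.

Lemma vsupP (A : set {i01 R}) : supremums A (vsup A).
Proof.
rewrite /vsup /supremum; case: eqVneq => [->|_].
  by split => // x _; rewrite -num_le/=.
by have [s sA] := supremums_neq0 A; case: xgetP => [? -> //|/(_ s)].
Qed.

Lemma vinfP (A : set {i01 R}) : infimums A (vinf A).
Proof.
have [s [s1 s2]] := supremums_neq0 (lbound A).
have sA : infimums A s by split=> // x Ax; apply: s2 => y; exact.
rewrite /vinf /infimum; case: eqVneq => [->|_].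
  by split => // x _; rewrite -num_le/=.
by case: xgetP => [? -> //|/(_ s)].
Qed.

Lemma vdivP (w t x : {i01 R}) : (w <= vdiv t x) = (tensor w x <= t).
Proof.
rewrite /vdiv; case: eqVneq => [->|x0].
  by rewrite -!num_le/= mulr0 ge0 le1.
rewrite -!num_le/= le_min ler_pdivlMr ?lt0r//.
  by rewrite [w%:num <= 1]le1 andbT.
by rewrite ge0 andbT; apply: contra_neq x0 => x0; exact/val_inj.
Qed.

End Quantale.

Section Filters.

Definition principal_pfilter {X : Type} (x : X) : pfilter_on X :=
  PFilterPack (principal_filter x) (principal_filter_proper x).

Definition image_pfilter {X Y : Type} (f : X -> Y) (F : pfilter_on X) :
    pfilter_on Y :=
  PFilterPack (fmap f F) (fmap_proper_filter f (pfilter_class F)).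

Lemma bigcap_proper (X : Type) (DD : set (pfilter_on X)) : DD !=set0 ->
  ProperFilter (\bigcap_(D in DD) (D : set_system X)).
Proof.
move=> [D0 DD0]; split.
  by move=> /(_ D0 DD0); exact: filter_not_empty.
split=> [D _|P Q FP FQ D DDD|P Q PQ FP D DDD].
- exact: filterT.
- by apply: filterI; [exact: FP|exact: FQ].
- by apply: filterS PQ _; exact: FP.
Qed.

Definition bigcap_pfilter {X : Type} (DD : set (pfilter_on X))
    (DD0 : DD !=set0) : pfilter_on X :=
  PFilterPack (\bigcap_(D in DD) (D : set_system X)) (bigcap_proper DD0).

End Filters.

Record convapp (R : realType) (X : Type) := ConvApp {
  limval :> pfilter_on X -> X -> {i01 R};
  limval_le : forall F G : pfilter_on X, F `<=` G -> (limval F <= limval G)%O;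
  limval_point : forall x, limval (principal_pfilter x) x = 1%:i01
}.

Definition is_morphism (R : realType) (X Y : Type) (lX : convapp R X)
    (lY : convapp R Y) (f : X -> Y) : Prop :=
  forall (F : pfilter_on X) (x : X), lX F x <= lY (image_pfilter f F) (f x).

Section StructureOnV.
Variable R : realType.

Definition limV (F : pfilter_on {i01 R}) (v : {i01 R}) : {i01 R} :=
  vdiv v (vinf [set vsup A | A in (F : set_system {i01 R})]).

Lemma limV_le (F G : pfilter_on {i01 R}) : F `<=` G -> (limV F <= limV G)%O.
Proof.
move=> FG; apply/lefP => v; rewrite vdivP.
have : limV F v <= limV F v by [].
rewrite {2}/limV vdivP; apply: le_trans.
rewrite -num_le/=; apply: ler_wpM2l => //; rewrite num_le.
have [_ h] := vinfP [set vsup A | A in (F : set_system {i01 R})].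
have [h' _] := vinfP [set vsup A | A in (G : set_system {i01 R})].
by apply: h => _ [A FA <-]; apply: h'; exists A => //; exact: FG.
Qed.

Lemma limV_point (v : {i01 R}) : limV (principal_pfilter v) v = 1%:i01.
Proof.
apply/eqP; rewrite eq_le; apply/andP; split; first by rewrite -num_le/=.
rewrite vdivP -num_le/= mul1r num_le.
have [h _] := vinfP [set vsup A | A in (principal_pfilter v : set_system _)].
apply: le_trans (h (vsup [set v]) _) _; first by exists [set v].
by have [_] := vsupP [set v]; apply=> x ->.
Qed.

Definition convappV : convapp R {i01 R} := ConvApp limV_le limV_point.

End StructureOnV.

Section Spaces.
Variables (R : realType) (X : Type).
Implicit Types (lam : convapp R X) (A : set X) (f g : X -> {i01 R}).

Definition contractions lam : set (X -> {i01 R}) :=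
  [set f | is_morphism lam (convappV R) f].

Definition adh lam A (x : X) : {i01 R} :=
  vsup [set lam U x | U in
    [set U : pfilter_on X | UltraFilter U /\ (U : set_system X) A]].

Definition adh_level lam A (e : {i01 R}) : set X := [set x | e <= adh lam A x].

Definition is_preapproach lam : Prop :=
  forall (DD : set (pfilter_on X)) (DD0 : DD !=set0) (x : X),
    lam (bigcap_pfilter DD0) x = vinf [set lam D x | D in DD].

Definition is_approach lam : Prop :=
  is_preapproach lam /\
  forall (A : set X) (x : X) (e : {i01 R}),
    tensor (adh lam (adh_level lam A e) x) e <= adh lam A x.

Definition indicV A (x : X) : {i01 R} := if x \in A then 1%:i01 else 0%:i01.

Definition is_lower_hull (l : (X -> {i01 R}) -> (X -> {i01 R})) : Prop :=
  [/\ forall f, (f <= l f)%O,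
      forall f g, l (f `|` g)%O = (l f `|` l g)%O,
      forall f, l (l f) = l f
    & forall f v, l (fun x => tensor (f x) v) = fun x => tensor (l f x) v].

(* A lower-hull operator is determined by its values on indicators, so there
   is at most one [l] with this property. *)
Definition is_lower_hull_of lam (l : (X -> {i01 R}) -> (X -> {i01 R})) : Prop :=
  is_lower_hull l /\ forall A, l (indicV A) = adh lam A.

Definition lower_regular_frame (l : (X -> {i01 R}) -> (X -> {i01 R})) :
    set (X -> {i01 R}) := [set f | l f = f].

Definition contraction_hull lam f (x : X) : {i01 R} :=
  vinf [set g x | g in [set g | contractions lam g /\ (f <= g)%O]].

End Spaces.

Definition is_approach_reflection (R : realType) (X : Type)
    (lam Tlam : convapp R X) : Prop :=
  [/\ is_approach Tlam,
      is_morphism lam Tlam id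
    & forall (Y : Type) (lY : convapp R Y) (h : X -> Y), is_approach lY ->
        is_morphism lam lY h -> is_morphism Tlam lY h].

(* Main.v *)
Require Import Defs.
From mathcomp Require Import all_boot all_order all_algebra.
From mathcomp Require Import interval_inference.
From mathcomp Require Import mathcomp_extra boolp classical_sets functions.
From mathcomp Require Import filter reals.

(* V is itself an approach space, so the reflection does not change the
   V-valued contractions.  By residuation these are closed under infima, binary
   joins, [_ (x) v] and [_ (/) v], so their hull is a lower-hull operator.  On an
   approach space [adh A] is the least contraction above the indicator of [A]:
   the tower axiom, applied to an ultrafilter finer than [F] that contains
   [adh_level A c], makes it a contraction, and a contraction equal to [1] on [A]
   has limit superior [1] along every ultrafilter containing [A]. *)

Set Implicit Arguments.
Unset Strict Implicit.
Unset Printing Implicit Defensive.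
Import Order.TTheory GRing.Theory Num.Theory.
Local Open Scope classical_set_scope.
Local Open Scope ring_scope.

(** * Residuation and approximation from below in $V$ *)

Section Quantale.
Variable R : realType.
Implicit Types (s t u v w c : {i01 R}) (A : set {i01 R}).

Lemma i01_ge0 v : 0%:i01 <= v.
Proof. by rewrite -num_le/=. Qed.

Lemma i01_le1 v : v <= 1%:i01.
Proof. by rewrite -num_le/=. Qed.

Lemma le_vsup A v : A v -> v <= vsup A.
Proof. by move=> Av; have [+ _] := vsupP A; exact. Qed.

Lemma vsup_le A v : (forall w, A w -> w <= v) -> vsup A <= v.
Proof. by have [_ +] := vsupP A; exact. Qed.

Lemma vinf_le A v : A v -> vinf A <= v.
Proof. by move=> Av; have [+ _] := vinfP A; exact. Qed.

Lemma le_vinf A v : (forall w, A w -> v <= w) -> v <= vinf A.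
Proof. by have [_ +] := vinfP A; exact. Qed.

(** The order of [V] is dense: if [t < s], their midpoint lies below [s] and above [t]. *)
Lemma le_lt_approx s t : (forall c, c < s -> c <= t) -> s <= t.
Proof.
move=> h; rewrite leNgt; apply/negP => ts.
have ts' : t%:num < s%:num by rewrite num_lt.
have m0 : 0 <= (t%:num + s%:num) / 2 by rewrite divr_ge0// addr_ge0.
have [tm ms] := midf_lt ts'.
have m1 : (t%:num + s%:num) / 2 <= 1 by rewrite (le_trans (ltW ms)).
have := h (Itv01 m0 m1); rewrite -num_lt -num_le/= => /(_ ms).
by rewrite leNgt tm.
Qed.

Lemma tensorC s t : tensor s t = tensor t s.
Proof. by apply/val_inj; rewrite /= mulrC. Qed.

Lemma tensorA s t u : tensor s (tensor t u) = tensor (tensor s t) u.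
Proof. by apply/val_inj; rewrite /= mulrA. Qed.

Lemma tensor1 s : tensor s 1%:i01 = s.
Proof. by apply/val_inj; rewrite /= mulr1. Qed.

Lemma tensor0 s : tensor s 0%:i01 = 0%:i01.
Proof. by apply/val_inj; rewrite /= mulr0. Qed.

Lemma le_tensor s t s' t' : s <= s' -> t <= t' -> tensor s t <= tensor s' t'.
Proof. by rewrite -!num_le/= => ss' tt'; exact: ler_pM. Qed.

(** By residuation [tensor w] preserves suprema, and [s] is the supremum of the [c] below it. *)
Lemma tensor_le_lt_approx w s t :
  (forall c, c < s -> tensor w c <= t) -> tensor w s <= t.
Proof.
move=> h; rewrite tensorC -vdivP; apply: le_lt_approx => c cs.
by rewrite vdivP tensorC; exact: h.
Qed.

Lemma vdivK s t : s <= t -> tensor (vdiv s t) t = s.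
Proof.
rewrite /vdiv; case: eqVneq => [->|t0 st].
  rewrite tensor0 => s0; apply/eqP.
  by rewrite eq_le s0 i01_ge0.
have t0' : 0 < t%:num.
  by rewrite lt0r ge0 andbT; apply: contra_neq t0 => t0; exact/val_inj.
apply/val_inj; rewrite /= min_l ?divfK ?gt_eqF//.
by rewrite ler_pdivrMr ?mul1r// num_le.
Qed.

(** Complements [vdivP], which concerns lower bounds of a quotient. Division by [0] gives [1], hence
    the restriction on [t]. *)
Lemma vdiv_le s t u : t != 0%:i01 -> s <= tensor u t -> vdiv s t <= u.
Proof.
move=> t0; rewrite /vdiv (negbTE t0) -!num_le/= => su.
have t0' : 0 < t%:num.
  by rewrite lt0r ge0 andbT; apply: contra_neq t0 => t0; exact/val_inj.
by rewrite ge_min ler_pdivrMr// su.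
Qed.

(* The [c] such that [u <= c] fails to be eventual approximate the limit superior
   of [F] from below. *)
Lemma le_limVP (F : pfilter_on {i01 R}) v w :
  w <= limV F v <->
  forall c, ~ (F : set_system {i01 R}) [set u | u <= c] -> tensor w c <= v.
Proof.
rewrite /limV vdivP; split=> [wF c Fc|h].
  apply: le_trans wF; apply: le_tensor => //; apply: le_vinf => _ [A FA <-].
  rewrite leNgt; apply/negP => Ac; apply: Fc; apply: filterS FA => u Au /=.
  by apply: le_trans (ltW Ac); exact: le_vsup.
apply: tensor_le_lt_approx => c cF; apply: h => Fc.
move: cF; apply/negP; rewrite -leNgt.
apply: (@le_trans _ _ (vsup [set u | u <= c])); last exact: vsup_le.
by apply: vinf_le; exists [set u | u <= c].
Qed.

End Quantale.

(** * Adherence and ultrafilter extensions *)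

Section Adherence.
Variables (R : realType) (X : Type).
Implicit Types (lam : convapp R X) (A : set X) (f g : X -> {i01 R}).
Implicit Types (v w c e : {i01 R}).

Lemma le_adh lam (U : pfilter_on X) A x : UltraFilter U ->
  (U : set_system X) A -> lam U x <= adh lam A x.
Proof. by move=> UU UA; apply: le_vsup; exists U. Qed.

Lemma adh_le lam A x v :
  (forall U : pfilter_on X, UltraFilter U -> (U : set_system X) A ->
    lam U x <= v) -> adh lam A x <= v.
Proof. by move=> h; apply: vsup_le => _ [U [UU UA] <-]; exact: h. Qed.

Lemma adh_mem lam A x : A x -> adh lam A x = 1%:i01.
Proof.
move=> Ax; apply: le_anti; rewrite i01_le1/= -(limval_point lam x).
by apply: le_adh; [exact: principal_filter_ultra|exact/principal_filterP].
Qed.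

Lemma adh0 lam x : adh lam set0 x = 0%:i01.
Proof.
apply: le_anti; rewrite i01_ge0 andbT; apply: adh_le => U _ U0.
by case: (filter_not_empty _ U0).
Qed.

Lemma ultra_extension (F : set_system X) : ProperFilter F ->
  exists U : pfilter_on X, UltraFilter U /\ F `<=` U.
Proof.
move=> /ultraFilterLemma[U [UU FU]].
by exists (PFilterPack U ultra_proper).
Qed.

Lemma ultra_meet (F : pfilter_on X) A : ~ (F : set_system X) (~` A) ->
  exists U : pfilter_on X,
    [/\ UltraFilter U, F `<=` U & (U : set_system X) A].
Proof.
(* [within A F] is generated by [F] and [A]; that it omits the empty set is precisely the
   hypothesis. *)
move=> FA; have WF : ProperFilter (within A F).
  by split; [exact: FA|exact: within_filter].
have [U [UU FU]] := ultra_extension WF.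
exists U; split=> //; last by apply: FU; exact: withinT.
by move=> B FB; apply: FU; apply: filterS FB.
Qed.

Lemma le_adh_limval lam A x (F : pfilter_on X) :
  ~ (F : set_system X) (~` A) -> lam F x <= adh lam A x.
Proof.
move=> /ultra_meet[U [UU FU UA]].
by apply: le_trans (le_adh _ _ UU UA); exact/lefP/limval_le.
Qed.

End Adherence.

(** * $V$ is an approach space *)

Section ApproachV.
Variable R : realType.
Implicit Types (A : set {i01 R}) (v w c e : {i01 R}).

(* The ultrafilter refines the base of initial segments of [A], hence converges
   to the infimum of [A]. *)
Lemma le_adhVP A v w : A !=set0 ->
  (w <= adh (convappV R) A v <-> forall c, lbound A c -> tensor w c <= v).
Proof.
move=> [a0 Aa0]; split=> [wA c Ac|h].
  apply: le_trans (le_tensor wA (lexx c)) _; rewrite -vdivP.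
  apply: adh_le => U UU UA; rewrite vdivP; apply: tensor_le_lt_approx => d dc.
  (* For [d < c] no point of [A] satisfies [u <= d], so [U] omits this initial segment. *)
  have /le_limVP : limV U v <= limV U v by [].
  apply=> Ud; apply: (filter_not_empty U).
  apply: filterS (filterI UA Ud) => u [/Ac cu /= ud].
  by move: dc; rewrite ltNge (le_trans cu ud).
pose B a := A `&` [set u | u <= a].
have BF : ProperFilter (filter_from A B).
  apply: filter_from_proper; last by move=> a Aa; exists a; split => /=.
  apply: filter_from_filter; first by exists a0.
  move=> a b Aa Ab; have [ab|ba] := leP a b.
    by exists a => // u [Au /= ua]; do !split => //=; exact: le_trans ab.
  by exists b => // u [Au /= ub]; do !split => //=; exact: le_trans (ltW ba).
have [U [UU FU]] := ultra_extension BF.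
apply: le_trans (le_adh _ _ UU _); last by apply: FU; exists a0 => // u [].
apply/le_limVP => c Uc; apply: h => a Aa; rewrite leNgt; apply/negP => ac.
apply: Uc; apply: FU; exists a => // u [_ /= ua].
exact: le_trans (ltW ac).
Qed.

(** An initial segment missing from an intersection of filters is missing from one of them, so the
    test of [le_limVP] passes to a single [D]. *)
Lemma preapproachV : is_preapproach (convappV R).
Proof.
move=> DD DD0 v; apply: le_anti; apply/andP; split.
  by apply: le_vinf => _ [D DDD <-]; apply/lefP/limval_le => A; exact.
apply/le_limVP => c /=/existsNP[D /not_implyP[DDD Dc]].
have /le_limVP : vinf [set convappV R D v | D in DD] <= limV D v.
  by apply: vinf_le; exists D.
exact.
Qed.

Lemma approachV : is_approach (convappV R).
Proof.
split=> [|A v e]; first exact: preapproachV.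
(* Set apart because at level [0] even the empty set has everything as its level set. *)
have [->|e0] := eqVneq e 0%:i01; first by rewrite tensor0 i01_ge0.
have [->|/set0P A0] := eqVneq A set0.
  rewrite (_ : adh_level _ _ _ = set0) ?adh0 1?tensorC ?tensor0//.
  apply/seteqP; split=> // u; rewrite /adh_level/= adh0 => e0'.
  by move/eqP: e0; apply; apply: le_anti; rewrite e0' i01_ge0.
apply/le_adhVP => // c Ac; rewrite -tensorA.
have [a Aa] := A0.
have E0 : adh_level (convappV R) A e !=set0.
  by exists a; rewrite /adh_level/= adh_mem// i01_le1.
(* Since [c] is a lower bound of [A], [tensor e c] is one of the level set, by the same
   criterion. *)
apply: (le_adhVP v _ E0).1 => // u /(le_adhVP u e A0); exact.
Qed.

End ApproachV.

(** * Closure properties of $V$-valued contractions *)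

Section Contractions.
Variables (R : realType) (X : Type) (lam : convapp R X).
Implicit Types (A : set X) (f g : X -> {i01 R}) (v w c e : {i01 R}).

(** The test of [le_limVP] pulled back along [f]; closure properties then reduce to comparing
    sublevel sets. *)
Lemma contractionP f : contractions lam f <->
  forall (F : pfilter_on X) x c, ~ (F : set_system X) [set y | f y <= c] ->
    tensor (lam F x) c <= f x.
Proof.
split=> [cf F x|h F x]; first exact: (le_limVP _ _ _).1 (cf F x).
by apply/le_limVP; exact: h.
Qed.

Lemma contraction_vinf (S : set (X -> {i01 R})) : S `<=` contractions lam ->
  contractions lam (fun x => vinf [set g x | g in S]).
Proof.
move=> Sc; apply/contractionP => F x c Fc; apply: le_vinf => _ [g Sg <-].
apply: (contractionP g).1 => [|Fg]; first exact: Sc.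
apply: Fc; apply: filterS Fg => y /= gc.
by apply: le_trans gc; apply: vinf_le; exists g.
Qed.

(** The sublevel set of a join is the intersection of the two sublevel sets; if it is not in [F],
    one of these is not, and that one gives the bound. *)
Lemma contraction_join f g : contractions lam f -> contractions lam g ->
  contractions lam (f `|` g)%O.
Proof.
move=> /contractionP cf /contractionP cg; apply/contractionP => F x c Fc.
have [Ff|/cf fx] := pselect ((F : set_system X) [set y | f y <= c]).
  have [Fg|/cg gx] := pselect ((F : set_system X) [set y | g y <= c]).
    case: Fc; apply: filterS (filterI Ff Fg) => y [/= fc gc].
    by have := leUx (f y) (g y) c; rewrite fc gc.
  by apply: le_trans (gx x) _; exact: leUr.
by apply: le_trans (fx x) _; exact: leUl.
Qed.

Lemma contraction_tensor f v : contractions lam f ->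
  contractions lam (fun x => tensor (f x) v).
Proof.
move=> /contractionP cf; apply/contractionP => F x c Fc.
(* The function is bounded by [v], so for [c] above [v] its sublevel set would be all of [X]. *)
have cv : c <= v.
  rewrite leNgt; apply/negP => vc; apply: Fc; apply: filterE => y /=.
  apply: le_trans (ltW vc).
  by apply: le_trans (le_tensor (i01_le1 _) (lexx v)) _; rewrite tensorC tensor1.
(* By residuation the sublevel set of [f] at [vdiv c v] is that of the product at [c]. *)
rewrite -{1}(vdivK cv) tensorA; apply: le_tensor => //; apply: cf => Ff.
by apply: Fc; apply: filterS Ff => y /=; rewrite vdivP.
Qed.

(** Used to move a factor across the inequality when the hull of a product is bounded below. *)
Lemma contraction_vdiv f v : contractions lam f ->
  contractions lam (fun x => vdiv (f x) v).
Proof.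
move=> /contractionP cf; apply/contractionP => F x c Fc; rewrite vdivP.
have [->|v0] := eqVneq v 0%:i01; first by rewrite tensor0 i01_ge0.
rewrite -tensorA; apply: cf => Ff; apply: Fc; apply: filterS Ff => y /=.
exact: vdiv_le.
Qed.

Lemma contraction_adh A : is_approach lam -> contractions lam (adh lam A).
Proof.
move=> [_ app]; apply/contractionP => F x c Fc.
apply: le_trans (app A x c); apply: le_tensor => //; apply: le_adh_limval.
(* Outside the [c]-level set the adherence is below [c], so the complement lies in the sublevel
   set. *)
apply: contra_not Fc; apply: filterS => y /= /negP.
by rewrite -ltNge => /ltW.
Qed.

Lemma adh_le_contraction A g : contractions lam g -> (indicV R A <= g)%O ->
  (adh lam A <= g)%O.
Proof.
move=> /contractionP cg /lefP Ag; apply/lefP => x.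
apply: adh_le => U UU UA; rewrite -[leLHS]tensor1.
(* As [g] is [1] on [A], its sublevel set at [c < 1] is disjoint from [A]. *)
apply: tensor_le_lt_approx => c c1; apply: cg => Ug.
apply: (filter_not_empty U).
apply: filterS (filterI UA Ug) => y [Ay /= gc].
move: (le_trans (Ag y) gc).
by rewrite /indicV mem_set// leNgt c1.
Qed.

(** * The hull operator and its fixed points *)

Local Notation hull := (contraction_hull lam).

Lemma contraction_contraction_hull f : contractions lam (hull f).
Proof. by apply: contraction_vinf => g []. Qed.

Lemma le_contraction_hull f : (f <= hull f)%O.
Proof. by apply/lefP => x; apply: le_vinf => _ [g [_ /lefP fg] <-]. Qed.

Lemma contraction_hull_le f g : contractions lam g -> (f <= g)%O ->
  (hull f <= g)%O.
Proof. by move=> cg fg; apply/lefP => x; apply: vinf_le; exists g. Qed.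

Lemma contraction_hull_id f : contractions lam f -> hull f = f.
Proof.
move=> cf; apply: le_anti.
by rewrite le_contraction_hull contraction_hull_le.
Qed.

Lemma contraction_hull_homo f g : (f <= g)%O -> (hull f <= hull g)%O.
Proof.
move=> fg; apply: contraction_hull_le.
  exact: contraction_contraction_hull.
exact: le_trans fg (le_contraction_hull g).
Qed.

Lemma contraction_hull_join f g : hull (f `|` g)%O = (hull f `|` hull g)%O.
Proof.
apply: le_anti; apply/andP; split.
  apply: contraction_hull_le; last by apply: leU2; exact: le_contraction_hull.
  by apply: contraction_join; exact: contraction_contraction_hull.
by rewrite leUx !contraction_hull_homo ?leUl ?leUr.
Qed.

Lemma contraction_hull_tensor f v :
  hull (fun x => tensor (f x) v) = fun x => tensor (hull f x) v.
Proof.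
apply: le_anti; apply/andP; split.
  apply: contraction_hull_le.
    exact/contraction_tensor/contraction_contraction_hull.
  by apply/lefP => x; apply: le_tensor => //; exact/lefP/le_contraction_hull.
(* The hull of the product, divided by [v], is a contraction above [f], hence above [hull f]. *)
apply/lefP => x; rewrite -vdivP; move: x; apply/lefP/contraction_hull_le.
  exact/contraction_vdiv/contraction_contraction_hull.
apply/lefP => x; rewrite vdivP.
by have /lefP := le_contraction_hull (fun x => tensor (f x) v); exact.
Qed.

Lemma contraction_hull_indicV A : is_approach lam ->
  hull (indicV R A) = adh lam A.
Proof.
move=> app; apply: le_anti; apply/andP; split.
  apply: contraction_hull_le; first exact: contraction_adh.
  apply/lefP => x; rewrite /indicV; case: ifPn => [/set_mem Ax|_].
    by rewrite adh_mem.
  exact: i01_ge0.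
apply: adh_le_contraction; first exact: contraction_contraction_hull.
exact: le_contraction_hull.
Qed.

Lemma is_lower_hull_contraction_hull : is_lower_hull hull.
Proof.
split; [exact: le_contraction_hull|exact: contraction_hull_join| |].
  by move=> f; apply/contraction_hull_id/contraction_contraction_hull.
exact: contraction_hull_tensor.
Qed.

Lemma lower_regular_frame_contraction_hull :
  lower_regular_frame hull = contractions lam.
Proof.
apply/seteqP; split=> f /=; last exact: contraction_hull_id.
by rewrite /lower_regular_frame/= => <-; exact: contraction_contraction_hull.
Qed.

End Contractions.

(** * Passage to the approach reflection *)

(** One inclusion is the universal property with target [V], the other composition with the identity
    morphism. *)
Lemma contractions_reflection (R : realType) (X : Type)
    (lam Tlam : convapp R X) : is_approach_reflection lam Tlam ->
  contractions lam = contractions Tlam.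
Proof.
move=> [_ idm univ]; apply/seteqP; split=> f cf.
  exact: univ (approachV R) cf.
move=> F x; apply: le_trans (idm F x) _.
exact: cf (image_pfilter id F) x.
Qed.

Theorem theorem23 (R : realType) (X : Type) (lam Tlam : convapp R X) :
  is_approach_reflection lam Tlam ->
  [/\ forall f : X -> {i01 R}, contractions lam (contraction_hull lam f),
      is_lower_hull_of Tlam (contraction_hull lam)
    & lower_regular_frame (contraction_hull lam) = contractions lam].
Proof.
move=> refl; have [app _ _] := refl.
(* The hull depends on the space only through its contractions, so it may be computed in [Tlam],
   where the tower axiom holds. *)
have hullE : contraction_hull lam = contraction_hull Tlam.
  by rewrite /contraction_hull (contractions_reflection refl).
split; first exact: contraction_contraction_hull.
- split; first exact: is_lower_hull_contraction_hull.
  by move=> A; rewrite hullE; exact: contraction_hull_indicV.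
- exact: lower_regular_frame_contraction_hull.
Qed.
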